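(* Let $m$ be a strictly positive integer and let $\lambda$ be a forbidden eigenvalue, i.e. one of the seven numbers $2$, $2\pm\sqrt2$, $2\pm\sqrt{2+\sqrt2}$, $2\pm\sqrt{2-\sqrt2}$. Then the Dirichlet eigenspace of $-\Delta_m$ associated with $\lambda$, namely $$\left\{u:V_m\to\mathbb{R}\;:\;u(P_0)=u(P_1)=0,\ -\Delta_m u(X)=\lambda\,u(X)\ \text{for all } X\in V_m\setminus V_0\right\},$$ has dimension one; that is, the multiplicity $M_m(\lambda)$ of $\lambda$ is equal to $1$.
   Context: Let $P_0=(0,0)$, $P_1=(1,0)$ in $\mathbb{R}^2$, and let $\mathcal{R}_\theta$ denote the rotation of $\mathbb{R}^2$ about the origin by the angle $\theta$. Define, for $X\in\mathbb{R}^2$ (vectors written as pairs): $f_1(X)=\frac14\left(X+(0,0)\right)$, $f_2(X)=\frac14\left(\mathcal{R}_{\pi/2}X+(1,0)\right)$, $f_3(X)=\frac14\left(X+(1,1)\right)$, $f_4(X)=\frac14\left(\mathcal{R}_{3\pi/2}X+(2,1)\right)$, $f_5(X)=\frac14\left(\mathcal{R}_{3\pi/2}X+(2,0)\right)$, $f_6(X)=\frac14\left(X+(2,-1)\right)$, $f_7(X)=\frac14\left(\mathcal{R}_{\pi/2}X+(3,-1)\right)$, $f_8(X)=\frac14\left(X+(3,0)\right)$. Set $V_0=\{P_0,P_1\}$ and $V_m=\bigcup_{i=1}^8 f_i(V_{m-1})$ for $m\geq1$. For a word $\mathcal{W}=(\mathcal{W}_1,\dots,\mathcal{W}_m)\in\{1,\dots,8\}^m$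 put $f_{\mathcal W}=f_{\mathcal{W}_1}\circ\cdots\circ f_{\mathcal{W}_m}$. Two points $X,Y\in V_m$ are adjacent, written $X\underset{m}{\sim}Y$, if there is a word $\mathcal W$ of length $m$ with $\{X,Y\}=\{f_{\mathcal W}(P_0),f_{\mathcal W}(P_1)\}$. For $m\geq1$ and $u:V_m\to\mathbb{R}$, the Laplacian of order $m$ is $\Delta_m u(X)=\sum_{Y\in V_m,\,Y\underset{m}{\sim}X}\left(u(Y)-u(X)\right)$ for $X\in V_m\setminus V_0$. *)

(* Defs.v *)
From HB Require Import structures.
From mathcomp Require Import all_boot all_order all_algebra.
From mathcomp Require Import finmap.
From mathcomp Require Import reals trigo.

Set Implicit Arguments.
Unset Strict Implicit.
Unset Printing Implicit Defensive.

Import Order.TTheory GRing.Theory Num.Theory.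
Local Open Scope fset_scope.
Local Open Scope ring_scope.

(* [R^o] is [R] as a module over itself, so that points can be scaled. *)
Notation plane R := (R^o * R^o)%type.

Section MinkowskiCurve.
Variable R : realType.
Implicit Types (X Y : plane R) (i : 'I_8) (m : nat) (lambda : R).

Definition pt (x y : R) : plane R := (x, y).

Definition P0 : plane R := pt 0 0.
Definition P1 : plane R := pt 1 0.

Definition rotation (theta : R) X : plane R :=
  pt (cos theta * X.1 - sin theta * X.2) (sin theta * X.1 + cos theta * X.2).

(* Letters are numbered from 0: [tnth similitudes i] is the map f_(i+1). *)
Definition similitudes : 8.-tuple (plane R -> plane R) :=
  [tuple (fun X => 4^-1 *: (X + pt 0 0));
         (fun X => 4^-1 *: (rotation (pi / 2) X + pt 1 0));
         (fun X => 4^-1 *: (X + pt 1 1));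
         (fun X => 4^-1 *: (rotation (3 * pi / 2) X + pt 2 1));
         (fun X => 4^-1 *: (rotation (3 * pi / 2) X + pt 2 0));
         (fun X => 4^-1 *: (X + pt 2 (- 1)));
         (fun X => 4^-1 *: (rotation (pi / 2) X + pt 3 (- 1)));
         (fun X => 4^-1 *: (X + pt 3 0))].

Definition sim i : plane R -> plane R := tnth similitudes i.

Definition sim_word m (W : m.-tuple 'I_8) X : plane R := foldr sim X W.

Fixpoint V m : {fset plane R} :=
  if m is m'.+1 then \bigcup_(i <- enum 'I_8) [fset sim i X | X in V m']
  else [fset P0; P1].

Definition adj m X Y : bool :=
  [exists W : m.-tuple 'I_8, [fset X; Y] == [fset sim_word W P0; sim_word W P1]].

Definition laplacian m (u : {ffun V m -> R}) (X : V m) : R :=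
  \sum_(Y : V m | adj m (val Y) (val X)) (u Y - u X).

Lemma mem_VS m i X : X \in V m -> sim i X \in V m.+1.
Proof.
move=> XV; apply/bigfcupP; exists i; first by rewrite mem_enum.
by apply/imfsetP; exists X.
Qed.

Lemma P0_in_V m : P0 \in V m.
Proof.
elim: m => [|m IHm]; first by rewrite !inE eqxx.
have -> : P0 = sim ord0 P0 by rewrite /sim (tnth_nth id) /= addr0 scaler0.
exact: mem_VS.
Qed.

Lemma P1_in_V m : P1 \in V m.
Proof.
elim: m => [|m IHm]; first by rewrite !inE eqxx orbT.
have -> : P1 = sim ord_max P1.
  rewrite /sim (tnth_nth id) /=; congr pair => /=; last by rewrite addr0 scaler0.
  by rewrite -natr1 addrC -[LHS](@mulVf _ 4) // pnatr_eq0.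
exact: mem_VS.
Qed.

Definition dirichlet_eigenfunction m lambda (u : {ffun V m -> R}) : Prop :=
  [/\ u [` P0_in_V m] = 0, u [` P1_in_V m] = 0
    & forall X : V m, val X \notin V 0 -> - laplacian u X = lambda * u X].

(* The eigenspace is realized as the kernel of the linear map which is the    *)
(* restriction on V_0 and - Delta_m - lambda elsewhere;                       *)
(* see [mem_dirichlet_eigenspace].                                            *)
Definition dirichlet_map m lambda (u : {ffun V m -> R^o}) : {ffun V m -> R^o} :=
  [ffun X => if val X \in V 0 then u X else - laplacian u X - lambda * u X].

Lemma dirichlet_map_is_linear m lambda : linear (@dirichlet_map m lambda).
Proof.
move=> a u v; apply/ffunP => X; rewrite !ffunE.
case: ifP => // _.
have -> : laplacian (a *: u + v) X = a * laplacian u X + laplacian v X.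
  rewrite /laplacian mulr_sumr -big_split /=; apply: eq_bigr => Y _.
  by rewrite !ffunE /GRing.scale /= mulrBr opprD addrACA.
by rewrite /GRing.scale /= mulrBr opprD mulrN mulrDr opprD mulrCA addrACA.
Qed.

HB.instance Definition _ m lambda :=
  GRing.isLinear.Build R {ffun V m -> R^o} {ffun V m -> R^o} _
    (@dirichlet_map m lambda) (@dirichlet_map_is_linear m lambda).

Definition dirichlet_eigenspace m lambda : {vspace {ffun V m -> R^o}} :=
  lker (linfun (@dirichlet_map m lambda)).

Lemma mem_dirichlet_eigenspace m lambda (u : {ffun V m -> R^o}) :
  u \in dirichlet_eigenspace m lambda <-> dirichlet_eigenfunction lambda u.
Proof.
have mem0 : P0 \in V 0 by exact: P0_in_V.
have mem1 : P1 \in V 0 by exact: P1_in_V.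
rewrite memv_ker lfunE; split=> [/eqP/ffunP u0|[u0 u1 uX]].
  split=> [||X /negPf XV].
  - by have := u0 [` P0_in_V m]; rewrite !ffunE mem0.
  - by have := u0 [` P1_in_V m]; rewrite !ffunE mem1.
  - by have := u0 X; rewrite !ffunE XV => /eqP; rewrite subr_eq0 => /eqP.
apply/eqP/ffunP => X; rewrite !ffunE.
case: ifPn => [|/uX ->]; last by rewrite subrr.
rewrite !inE => /orP[]/eqP XP; [rewrite -[RHS]u0|rewrite -[RHS]u1];
  by congr (u _); apply: val_inj.
Qed.

Definition forbidden_eigenvalues : seq R :=
  [:: 2; 2 + Num.sqrt 2; 2 - Num.sqrt 2;
      2 + Num.sqrt (2 + Num.sqrt 2); 2 - Num.sqrt (2 + Num.sqrt 2);
      2 + Num.sqrt (2 - Num.sqrt 2); 2 - Num.sqrt (2 - Num.sqrt 2)].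

End MinkowskiCurve.

(* Main.v *)
(* V_m is the vertex set of a simple path with 8 ^ m edges from P0 to P1. It   *)
(* does not touch itself because, in the coordinates s = x + y, t = x - y, the *)
(* eight similitudes send the unit square to eight distinct cells of the 4 x 4 *)
(* grid, and swap the open and closed sides of [0 < s < 1, 0 <= t <= 1] in a   *)
(* consistent way: the images of this half-open square, with the corners P0    *)
(* and P1 added, only meet at the common ends of consecutive pieces. So the    *)
(* eigenvalue equation is the recurrence                                       *)
(* u_(k+2) = (2 - lambda) u_(k+1) - u_k with u_0 = u_(8^m) = 0. A solution is  *)
(* determined by u_1, and the one with u_1 = 1 vanishes at all multiples of 8, *)
(* since the forbidden eigenvalues are exactly those for which u_8 = 0.        *)

Require Import Defs.
From mathcomp Require Import all_boot all_order all_algebra.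
From mathcomp Require Import finmap reals trigo.
From mathcomp Require Import zify ring lra.

Set Implicit Arguments.
Unset Strict Implicit.
Unset Printing Implicit Defensive.

Import Order.TTheory GRing.Theory Num.Theory.

(** Numbering the vertices along the path turns the problem into a scalar recurrence. The geometry
    lies in [sim_cell_meet], from which [vertex_inj] follows by induction on the level. Then
    [adj_vertex] identifies adjacency with consecutive indices, and [dirichlet_vertexP] restates the
    eigenvalue problem. By [recurrence_cheb] its solutions are multiples of [cheb], which vanishes
    at [8 ^ m] by [cheb8_forbidden] and [cheb_multiple]. *)

Section Similitudes.
Local Open Scope ring_scope.
Variable R : realType.
Implicit Types (X Y : plane R) (i j : 'I_8) (x y : R).

Lemma cos_3pihalf : cos (3 * pi / 2) = 0 :> R.
Proof.
have -> : 3 * pi / 2 = pi / 2 + pi :> R by field.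
by rewrite cosDpi cos_pihalf oppr0.
Qed.

Lemma sin_3pihalf : sin (3 * pi / 2) = -1 :> R.
Proof.
have -> : 3 * pi / 2 = pi / 2 + pi :> R by field.
by rewrite sinDpi sin_pihalf.
Qed.

Definition sim_coord (n : nat) (x y : R) : plane R :=
  match n with
  | 0 => (x / 4, y / 4)
  | 1 => ((1 - y) / 4, x / 4)
  | 2 => ((x + 1) / 4, (y + 1) / 4)
  | 3 => ((y + 2) / 4, (1 - x) / 4)
  | 4 => ((y + 2) / 4, - x / 4)
  | 5 => ((x + 2) / 4, (y - 1) / 4)
  | 6 => ((3 - y) / 4, (x - 1) / 4)
  | _ => ((x + 3) / 4, y / 4)
  end.

Lemma simE i x y : sim i (x, y) = sim_coord i x y.
Proof.
case: i => -[|[|[|[|[|[|[|[|//]]]]]]]] i_lt.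
all: rewrite /sim (tnth_nth id) /= /rotation ?cos_pihalf ?sin_pihalf.
all: rewrite ?cos_3pihalf ?sin_3pihalf /pt /=.
all: congr pair; rewrite /= /GRing.scale /=; by field.
Qed.

Definition half_open_diamond X :=
  [/\ 0 < X.1 + X.2 :> R, X.1 + X.2 < 1 :> R, 0 <= X.1 - X.2 :> R
    & X.1 - X.2 <= 1 :> R].

Definition cell X := [\/ X = P0 R, X = P1 R | half_open_diamond X].

Lemma sim_inj i : injective (sim i : plane R -> plane R).
Proof.
move=> [x y] [x' y']; rewrite !simE.
case: i => -[|[|[|[|[|[|[|[|//]]]]]]]] i_lt /= [e1 e2]; congr pair; lra.
Qed.

Lemma sim_cell i X : cell X -> cell (sim i X).
Proof.
case: X => x y; rewrite simE /cell /half_open_diamond /P0 /P1 /pt.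
case: i => -[|[|[|[|[|[|[|[|//]]]]]]]] i_lt.
all: rewrite /sim_coord /= => -[[-> ->]|[-> ->]|[/= h1 h2 h3 h4]].
all: try by constructor 3; split=> /=; lra.
  (* What remains is [P0], fixed by the first map, and [P1], fixed by the last. *)
  by constructor 1; congr pair; lra.
by constructor 2; congr pair; lra.
Qed.

Lemma sim_P0_succ i j : j = i.+1 :> nat -> sim j (P0 R) = sim i (P1 R).
Proof.
move=> ji; have := ltn_ord j; rewrite /P0 /P1 /pt !simE ji.
case: i {ji} => -[|[|[|[|[|[|[|[|//]]]]]]]] i_lt //= _; congr pair; lra.
Qed.

Lemma sim_cell_meet i j X Y : (i < j)%N -> cell X -> cell Y ->
  sim i X = sim j Y -> [/\ j = i.+1 :> nat, X = P1 R & Y = P0 R].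
Proof.
case: X Y => [x y] [x' y']; rewrite !simE /cell /half_open_diamond /P0 /P1 /pt.
case: i => -[|[|[|[|[|[|[|[|//]]]]]]]] i_lt.
all: case: j => -[|[|[|[|[|[|[|[|//]]]]]]]] j_lt //= _.
all: move=> [[-> ->]|[-> ->]|[/= h1 h2 h3 h4]].
all: move=> [[-> ->]|[-> ->]|[/= h1' h2' h3' h4']] /pair_equal_spec[e1 e2].
(* These are the junctions of consecutive pieces; any other coincidence contradicts the linear
   constraints. *)
all: try by split.
all: exfalso; lra.
Qed.

End Similitudes.

(** * Numbering of the vertices along the path *)

Section VertexPath.
Local Open Scope ring_scope.
Variable R : realType.
Implicit Types (X Y : plane R) (i : 'I_8) (m k : nat).

(* [minn _ 7] makes the last index [8 ^ m] the end of the last piece; larger   *)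
(* indices all give P1.                                                        *)
Fixpoint vertex m k : plane R :=
  if m is m'.+1 then
    let i := minn (k %/ 8 ^ m') 7 in sim (inord i) (vertex m' (k - i * 8 ^ m'))
  else if k is 0 then P0 R else P1 R.

Lemma sim0_P0 : sim ord0 (P0 R) = P0 R.
Proof. by rewrite /P0 /pt simE /= mul0r. Qed.

Lemma sim7_P1 : sim ord_max (P1 R) = P1 R.
Proof. by rewrite /P1 /pt simE /=; congr pair; lra. Qed.

Lemma vertex0 m : vertex m 0 = P0 R.
Proof.
by elim: m => //= m IHm; rewrite div0n min0n subn0 IHm (inord_val ord0) sim0_P0.
Qed.

Lemma vertex_last m : vertex m (8 ^ m) = P1 R.
Proof.
elim: m => //= m IHm; rewrite expnS mulnK ?expn_gt0 // minnE /=.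
by rewrite -mulnBl mul1n IHm (inord_val ord_max) sim7_P1.
Qed.

Lemma vertexS m i k : (k <= 8 ^ m)%N ->
  vertex m.+1 (i * 8 ^ m + k) = sim i (vertex m k).
Proof.
have pow_gt0 : (0 < 8 ^ m)%N by rewrite expn_gt0.
rewrite leq_eqVlt => /predU1P[->|k_lt].
  (* [vertex] reads the end of piece [i] as the start of piece [i.+1], except for the last piece,
     where [minn] stops it. *)
  rewrite addnC -mulSn /= mulnK //.
  have [i_lt|i_ge] := ltnP i 7.
    rewrite (minn_idPl _) // subnn vertex0 vertex_last.
    by apply: sim_P0_succ; rewrite inordK.
  have -> : i = ord_max by apply: val_inj => /=; have := ltn_ord i; lia.
  rewrite minnE /= -mulnBl mul1n vertex_last.
  by rewrite (inord_val ord_max).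
rewrite /= divnMDl // divn_small // addn0 (minn_idPl (leq_ord i)).
by rewrite addKn inord_val.
Qed.

Lemma index_split m k : (k <= 8 ^ m.+1)%N ->
  exists i j, (j <= 8 ^ m)%N /\ k = (i * 8 ^ m + j)%N.
Proof.
have pow_gt0 : (0 < 8 ^ m)%N by rewrite expn_gt0.
rewrite leq_eqVlt => /predU1P[->|k_lt].
  by exists ord_max, (8 ^ m)%N; rewrite expnS /= -mulSnr.
have i_lt : (k %/ 8 ^ m < 8)%N by rewrite ltn_divLR // -expnS.
by exists (Ordinal i_lt), (k %% 8 ^ m)%N; rewrite /= -divn_eq ltnW ?ltn_mod.
Qed.

Lemma vertex_in_V m k : vertex m k \in V R m.
Proof.
elim: m k => [|m IHm] k /=; last exact: mem_VS.
by case: k => [|k]; rewrite !inE eqxx ?orbT.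
Qed.

Lemma V_vertex m X : X \in V R m -> exists2 k, (k <= 8 ^ m)%N & X = vertex m k.
Proof.
elim: m X => [|m IHm] X.
  by rewrite !inE => /orP[]/eqP ->; [exists 0%N|exists 1%N].
case/bigfcupP => i _ /imfsetP[Y /IHm[k k_le ->] ->].
exists (i * 8 ^ m + k)%N; last by rewrite vertexS.
by rewrite expnS; have := ltn_ord i; nia.
Qed.

Lemma cell_vertex m k : cell (vertex m k).
Proof.
elim: m k => [|m IHm] [|k] /=; try exact: sim_cell.
  by constructor 1.
by constructor 2.
Qed.

Lemma vertex_inj m k l : (k <= 8 ^ m)%N -> (l <= 8 ^ m)%N ->
  vertex m k = vertex m l -> k = l.
Proof.
elim: m k l => [|m IHm].
  by case=> [|[|//]] [|[|//]] _ _ //= [] e; exfalso; lra.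
move=> k l /index_split[i [j [j_le ->]]] /index_split[i' [j' [j'_le ->]]].
rewrite !vertexS //.
wlog ii' : i i' j j' j_le j'_le / (i <= i')%N => [H|].
  by case/orP: (leq_total i i') => ii'; [|symmetry]; apply: H.
move: ii'; rewrite leq_eqVlt => /predU1P[/val_inj <- /sim_inj/IHm ->//|ii'].
(* Distinct pieces meet only at a junction, whose two descriptions (offset [8 ^ m] in one piece,
   offset 0 in the next) give the same index. *)
move=> /(sim_cell_meet ii' (cell_vertex _ _) (cell_vertex _ _))[->].
rewrite -(vertex_last m) -(vertex0 m) => /IHm-> // /IHm-> //.
by rewrite mulSnr addn0.
Qed.

End VertexPath.

(** * From adjacency to a three-term recurrence *)

Section Adjacency.
Local Open Scope fset_scope.
Local Open Scope ring_scope.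
Variable R : realType.
Implicit Types (X Y : plane R) (m k : nat).

(** The letters of [W] are the base 8 digits of [k], most significant first. *)
Lemma word_edge m (W : m.-tuple 'I_8) : exists2 k, (k < 8 ^ m)%N &
  sim_word W (P0 R) = vertex R m k /\ sim_word W (P1 R) = vertex R m k.+1.
Proof.
elim: m W => [|m IHm] W; first by exists 0%N; rewrite // (tuple0 W).
case/tupleP: W => i W; have [k k_lt [W0 W1]] := IHm W.
exists (i * 8 ^ m + k)%N; first by rewrite expnS; have := ltn_ord i; nia.
by rewrite -addnS !vertexS ?(ltnW k_lt) // -W0 -W1.
Qed.

Lemma edge_word m k : (k < 8 ^ m)%N -> exists W : m.-tuple 'I_8,
  sim_word W (P0 R) = vertex R m k /\ sim_word W (P1 R) = vertex R m k.+1.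
Proof.
elim: m k => [|m IHm] k k_lt.
  by exists [tuple]; case: k k_lt => [|[]].
have pow_gt0 : (0 < 8 ^ m)%N by rewrite expn_gt0.
have i_lt : (k %/ 8 ^ m < 8)%N by rewrite ltn_divLR // -expnS.
have j_lt : (k %% 8 ^ m < 8 ^ m)%N by rewrite ltn_mod.
have [W [W0 W1]] := IHm _ j_lt.
exists [tuple of Ordinal i_lt :: W].
rewrite -[sim_word _ (P0 R)]/(sim _ (sim_word W (P0 R))) W0.
rewrite -[sim_word _ (P1 R)]/(sim _ (sim_word W (P1 R))) W1.
by rewrite -!vertexS ?(ltnW j_lt) //= addnS -divn_eq.
Qed.

Lemma adj_vertex m k l : (k <= 8 ^ m)%N -> (l <= 8 ^ m)%N ->
  adj m (vertex R m k) (vertex R m l) = (k == l.+1) || (l == k.+1).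
Proof.
move=> k_le l_le; apply/existsP/idP => [[W /eqP e]|].
  have [n n_lt [W0 W1]] := word_edge W.
  have inj a b : (a <= 8 ^ m)%N -> (b <= 8 ^ m)%N ->
      (vertex R m a == vertex R m b) = (a == b).
    by move=> a_le b_le; apply/eqP/eqP => [/vertex_inj->|->].
  move: e; rewrite W0 W1 => /fsetP e.
  (* Testing the equality of the two pairs at their four elements leaves, by injectivity, arithmetic
     on indices. *)
  have := (e (vertex R m k), e (vertex R m l)).
  have := (e (vertex R m n), e (vertex R m n.+1)).
  by rewrite !inE !inj ?(ltnW n_lt) // => -[] + + []; lia.
wlog lk : k l k_le l_le / l = k.+1 => [H|].
  case/orP => /eqP kl; last by apply: H => //; rewrite kl eqxx orbT.
  by rewrite fsetUC; apply: H => //; rewrite kl eqxx orbT.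
rewrite lk in l_le *; have [W [W0 W1]] := edge_word l_le.
by exists W; rewrite W0 W1.
Qed.

Definition vertexV m k : V R m := [` vertex_in_V R m k].

Lemma vertexV0 m : vertexV m 0 = [` P0_in_V R m].
Proof. by apply: val_inj; rewrite /= vertex0. Qed.

Lemma vertexV_last m : vertexV m (8 ^ m) = [` P1_in_V R m].
Proof. by apply: val_inj; rewrite /= vertex_last. Qed.

Lemma vertexV_surj m (X : V R m) : exists2 k, (k <= 8 ^ m)%N & X = vertexV m k.
Proof.
have [k k_le Xk] := V_vertex (valP X).
by exists k => //; apply: val_inj.
Qed.

Lemma vertexV_inj m k l : (k <= 8 ^ m)%N -> (l <= 8 ^ m)%N ->
  vertexV m k = vertexV m l -> k = l.
Proof. by move=> k_le l_le /(congr1 val) /=; apply: vertex_inj. Qed.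

Lemma vertex_in_V0 m k : (k <= 8 ^ m)%N ->
  (vertex R m k \in V R 0) = (k == 0%N) || (k == 8 ^ m)%N.
Proof.
move=> k_le; rewrite !inE -(vertex0 R m) -(vertex_last R m).
by congr orb; apply/eqP/eqP => [/vertex_inj->|->].
Qed.

Lemma laplacian_vertex m (u : {ffun V R m -> R}) k : (k.+2 <= 8 ^ m)%N ->
  laplacian u (vertexV m k.+1) =
    u (vertexV m k.+2) + u (vertexV m k) - 2 * u (vertexV m k.+1).
Proof.
move=> k_le; rewrite /laplacian.
rewrite (bigD1 (vertexV m k)) /=; last by rewrite adj_vertex //; lia.
rewrite (bigD1 (vertexV m k.+2)) /=; last first.
  rewrite adj_vertex ?eqxx //; last lia.
  by apply/eqP => /vertexV_inj; lia.
rewrite big1 => [|Y /andP[/andP[]]]; first by ring.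
have [l l_le ->] := vertexV_surj Y.
rewrite adj_vertex //; last lia.
by case/orP=> /eqP; [move=> -> _|case=> ->]; rewrite eqxx.
Qed.

Lemma dirichlet_vertexP m lambda (u : {ffun V R m -> R}) :
  dirichlet_eigenfunction lambda u <->
  [/\ u (vertexV m 0) = 0, u (vertexV m (8 ^ m)) = 0
    & forall k, (k.+2 <= 8 ^ m)%N ->
        u (vertexV m k.+2) = (2 - lambda) * u (vertexV m k.+1) - u (vertexV m k)].
Proof.
rewrite vertexV0 vertexV_last; split=> -[u0 u1 uX]; split=> //.
  move=> k k_le.
  have k_notin : val (vertexV m k.+1) \notin V R 0 by rewrite vertex_in_V0; lia.
  by have := uX _ k_notin; rewrite laplacian_vertex //; lra.
move=> X; have [[|k] k_le ->] := vertexV_surj X; rewrite vertex_in_V0 //=.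
move=> k_neq; have {k_neq}k_lt : (k.+2 <= 8 ^ m)%N by lia.
by rewrite laplacian_vertex // uX //; ring.
Qed.

End Adjacency.

(** * Chebyshev sequences *)

Section LinearRecurrence.
Local Open Scope ring_scope.
Variables (R : comPzRingType) (c : R).
Implicit Types (v : nat -> R) (k n : nat).

(* [cheb k] is U_(k-1)(c / 2), U being the Chebyshev polynomials of the second *)
(* kind.                                                                       *)
Fixpoint cheb k : R :=
  match k with
  | 0 => 0
  | k'.+1 => match k' with 0 => 1 | k''.+1 => c * cheb k' - cheb k'' end
  end.

Lemma chebSS k : cheb k.+2 = c * cheb k.+1 - cheb k.
Proof. by []. Qed.

(** Two initial values determine a solution. The bound [n] is there because an eigenfunction obeys
    the recurrence only up to index [8 ^ m]. *)
Lemma recurrence_cheb v n : v 0%N = 0 ->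
  (forall k, (k.+2 <= n)%N -> v k.+2 = c * v k.+1 - v k) ->
  forall k, (k <= n)%N -> v k = v 1%N * cheb k.
Proof.
move=> v0 vSS k; elim/ltn_ind: k => -[|[|k]] IHk k_le; rewrite ?mulr0 ?mulr1 //.
rewrite vSS // (IHk k.+1) ?(ltnW k_le) // (IHk k) ?(ltnW (ltnW k_le)) //.
by rewrite chebSS; ring.
Qed.

(** The sequence shifted by [n] also solves the recurrence and starts at 0, so it is a multiple of
    [cheb]. *)
Lemma cheb_multiple n k : cheb n = 0 -> cheb (k * n) = 0.
Proof.
move=> n0; elim: k => [//|k IHk].
rewrite mulSn addnC.
by rewrite (@recurrence_cheb (fun j => cheb (j + n)) (k * n)) ?IHk ?mulr0 // addnC.
Qed.

End LinearRecurrence.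

(** * Forbidden eigenvalues and the dimension *)

Section DirichletEigenspace.
Local Open Scope ring_scope.
Variable R : realType.
Implicit Types (m : nat) (lambda : R).

Lemma cheb8_forbidden lambda :
  lambda \in forbidden_eigenvalues R -> cheb (2 - lambda) 8 = 0.
Proof.
have s2 : Num.sqrt 2 ^+ 2 = 2 :> R by rewrite sqr_sqrtr.
have s2_ge0 : 0 <= Num.sqrt 2 :> R by rewrite sqrtr_ge0.
have sp : Num.sqrt (2 + Num.sqrt 2) ^+ 2 = 2 + Num.sqrt 2 :> R.
  by rewrite sqr_sqrtr // addr_ge0.
have sm : Num.sqrt (2 - Num.sqrt 2) ^+ 2 = 2 - Num.sqrt 2 :> R.
  by rewrite sqr_sqrtr // subr_ge0; nra.
(* For [c = 2 cos t] this is [sin (8 t) / sin t = 8 cos t cos (2 t) cos (4 t)]. *)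
have cheb8 (c : R) :
  cheb c 8 = c * (c ^+ 2 - 2) * ((c ^+ 2 - 2) ^+ 2 - 2) by rewrite /=; ring.
have two_sub (x : R) : 2 - (2 + x) = - x by ring.
have two_sub' (x : R) : 2 - (2 - x) = x by ring.
have addK (x : R) : 2 + x - 2 = x by ring.
have subK (x : R) : 2 - x - 2 = - x by ring.
rewrite cheb8 !inE; do ?[case/orP]; move=> /eqP->.
all: rewrite ?two_sub ?two_sub' ?sqrrN ?s2 ?sp ?sm.
all: by rewrite ?addK ?subK ?sqrrN ?s2 ?subrr ?mulr0 ?mul0r.
Qed.

Lemma dim_dirichlet_eigenspace m lambda : cheb (2 - lambda) (8 ^ m) = 0 ->
  \dim (dirichlet_eigenspace m lambda) = 1%N.
Proof.
set c := 2 - lambda => cheb_last.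
have pow_ge1 : (1 <= 8 ^ m)%N by rewrite expn_gt0.
(* Listing the vertices in path order lets [index] invert the numbering and carry [cheb] over to a
   function on [V m]. *)
pose s := [seq vertexV R m k | k <- iota 0 (8 ^ m).+1].
have s_uniq : uniq s.
  rewrite map_inj_in_uniq ?iota_uniq // => k l.
  by rewrite !mem_iota => k_le l_le; apply: vertexV_inj.
have s_index k : (k <= 8 ^ m)%N -> index (vertexV R m k) s = k.
  move=> k_le; have <- : nth (vertexV R m 0) s k = vertexV R m k.
    by rewrite (nth_map 0%N) ?size_iota // nth_iota.
  by rewrite index_uniq ?size_map ?size_iota.
pose w : {ffun V R m -> R^o} := [ffun X => cheb c (index X s)].
have w_vertex k : (k <= 8 ^ m)%N -> w (vertexV R m k) = cheb c k.
  by move=> k_le; rewrite ffunE s_index.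
have w_neq0 : w != 0.
  apply/eqP => /ffunP/(_ (vertexV R m 1)); rewrite w_vertex // ffunE => /eqP.
  by rewrite oner_eq0.
suff -> : dirichlet_eigenspace m lambda = <[w]>%VS by rewrite dim_vline w_neq0.
apply/vspaceP => u; apply/idP/vlineP => [|[a ->]].
  move=> /mem_dirichlet_eigenspace/dirichlet_vertexP[u0 _ uSS].
  exists (u (vertexV R m 1)); apply/ffunP => X.
  have [k k_le ->] := vertexV_surj X.
  rewrite ffunE w_vertex //.
  exact: (recurrence_cheb (v := fun k => u (vertexV R m k)) u0 uSS).
apply/memvZ/mem_dirichlet_eigenspace/dirichlet_vertexP.
by split=> [||k k_le]; rewrite !w_vertex //; lia.
Qed.

End DirichletEigenspace.

Theorem theorem6p1 (R : realType) (m : nat) (lambda : R) :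
  0 < m -> lambda \in forbidden_eigenvalues R ->
  \dim (dirichlet_eigenspace m lambda) = 1.
Proof.
move=> m_gt0 /cheb8_forbidden cheb8_0; apply: dim_dirichlet_eigenspace.
by rewrite -(prednK m_gt0) expnSr cheb_multiple.
Qed.
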